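(* Let $(X_n)_{n\in\mathbb{Z}_+}$ be an inhomogeneous INAR(1) process with offspring means $\varrho_n=\mathsf{E}\xi_{n,1}$ and immigration variables $\varepsilon_n$, such that $\mathsf{P}(\varepsilon_n\in\{0,1\})=1$ for all $n\in\mathbb{N}$. Write $m_{n,1}=\mathsf{E}\varepsilon_n$. Assume that (i) $\varrho_n<1$ for all $n\in\mathbb{N}$, $\lim_{n\to\infty}\varrho_n=1$, and $\sum_{n=1}^\infty(1-\varrho_n)=\infty$; (ii) $\lim_{n\to\infty}\frac{m_{n,1}}{1-\varrho_n}=\lambda\in[0,\infty)$. Then $X_n$ converges in distribution to the Poisson distribution $\mathrm{Po}(\lambda)$ as $n\to\infty$.
   Context: An inhomogeneous INAR(1) process $(X_n)_{n\in\mathbb{Z}_+}$ is defined by $X_0=0$ and $X_n=\sum_{j=1}^{X_{n-1}}\xi_{n,j}+\varepsilon_n$ for $n\in\mathbb{N}$, where $\{\xi_{n,j},\varepsilon_n:n,j\in\mathbb{N}\}$ are independent non-negative integer-valued random variables such that, for each $n\in\mathbb{N}$, the variables $\{\xi_{n,j}:j\in\mathbb{N}\}$ are identically distributed and $\mathsf{P}(\xi_{n,1}\in\{0,1\})=1$. The offspring means are $\varrho_n:=\mathsf{E}\xi_{n,1}\in[0,1]$. $\mathrm{Po}(\lambda)$ is the Poisson distribution with mean $\lambda$; $\mathrm{Po}(0)$ is the Dirac measure concentrated at $0$. *)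

(* Defs.v *)
From HB Require Import structures.
From mathcomp Require Import all_boot all_order all_algebra finmap.
From mathcomp Require Import all_classical all_reals all_analysis.
Import Order.TTheory GRing.Theory Num.Theory.
Import numFieldNormedType.Exports.

Set Implicit Arguments.
Unset Strict Implicit.
Unset Printing Implicit Defensive.

Local Open Scope classical_set_scope.
Local Open Scope ring_scope.

Definition real_of_nat (R : realType) (n : nat) : R := n%:R.

Lemma measurable_real_of_nat (R : realType) :
  measurable_fun [set: nat] (@real_of_nat R).
Proof. by []. Qed.

HB.instance Definition _ (R : realType) :=
  isMeasurableFun.Build _ _ nat R (@real_of_nat R)
    (@measurable_real_of_nat R).

(* [poisson_prob lambda k] does not depend on the argument [k], and it is the
   Dirac measure at 0 when [lambda = 0]. *)
Definition Po (R : realType) (lambda : R) : probability R R :=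
  distribution (poisson_prob lambda 0) (@real_of_nat R).

Definition cvg_in_distribution (d : measure_display) (T : measurableType d)
    (R : realType) (P : probability T R) (Y : nat -> {RV P >-> R})
    (mu : probability R R) : Prop :=
  forall f : R -> R, continuous f -> bounded_fun f ->
    'E_P[f \o Y n]%E @[n --> \oo] --> (\int[mu]_x (f x)%:E)%E.

Arguments cvg_in_distribution {d T R} P Y mu.

Definition mutually_independent (d d' : measure_display)
    (T : measurableType d) (T' : measurableType d') (R : realType)
    (P : probability T R) (I : choiceType) (J : set I)
    (Y : I -> {RV P >-> T'}) : Prop :=
  forall (F : {fset I}) (B : I -> set T'),
    [set` F] `<=` J -> (forall i, measurable (B i)) ->
    P (\bigcap_(i in [set` F]) (Y i @^-1` B i)) =
    (\prod_(i <- F) P (Y i @^-1` B i))%E.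

Arguments mutually_independent {d d' T T' R} P {I} J Y.

(* The family {xi_(n,j), eps_n}; only its members with positive indices
   ([positive_index]) belong to the model. *)
Definition innovations (d : measure_display) (T : measurableType d)
    (R : realType) (P : probability T R) (xi : nat -> nat -> {RV P >-> nat})
    (eps : nat -> {RV P >-> nat}) (i : nat * nat + nat) : {RV P >-> nat} :=
  match i with inl (n, j) => xi n j | inr n => eps n end.

Definition positive_index : set (nat * nat + nat) :=
  [set i | match i with
           | inl (n, j) => (0 < n)%N && (0 < j)%N
           | inr n => (0 < n)%N
           end].

Record inhomogeneous_INAR1 (d : measure_display) (T : measurableType d)
    (R : realType) (P : probability T R) (xi : nat -> nat -> {RV P >-> nat})
    (eps X : nat -> {RV P >-> nat}) : Prop := {
  INAR1_indep : mutually_independent P positive_index (innovations xi eps) ;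
  INAR1_ident : forall n j, (0 < n)%N -> (0 < j)%N ->
    distribution P (xi n j) =1 distribution P (xi n 1%N) ;
  INAR1_bernoulli : forall n, (0 < n)%N ->
    P (xi n 1%N @^-1` [set 0%N; 1%N]) = 1%E ;
  INAR1_init : forall w, X 0%N w = 0%N ;
  INAR1_step : forall n w, (0 < n)%N ->
    X n w = (\sum_(1 <= j < (X n.-1 w).+1) xi n j w + eps n w)%N
}.

Arguments inhomogeneous_INAR1 {d T R} P xi eps X.

(* Main.v *)
(** Write r_n and m_n for the means of the offspring and of the immigration.
    The generating function G_n of X_n satisfies
    G_n(x) = G_{n-1}(1 - r_n (1 - x)) (1 - m_n (1 - x)).  Comparing with
    H(x) = exp (- lambda (1 - x)), which satisfies the same recursion up to an
    error (1 - r_n) delta_n (1 - x) with delta_n -> 0, gives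
    |G_n(x) - H(x)| <= D_n (1 - x) with
    D_n = r_n D_{n-1} + (1 - r_n) delta_n, and D_n -> 0 because the series
    of the 1 - r_n diverges.  Pointwise convergence of the generating functions
    gives convergence of the point masses, hence convergence in law. *)

Require Import Defs.
From HB Require Import structures.
From mathcomp Require Import all_boot all_order all_algebra finmap.
From mathcomp Require Import all_classical all_reals all_analysis.
From mathcomp Require Import measurable_realfun ring lra.
Import Order.TTheory GRing.Theory Num.Theory.
Import numFieldNormedType.Exports.

Set Implicit Arguments.
Unset Strict Implicit.
Unset Printing Implicit Defensive.

Local Open Scope classical_set_scope.
Local Open Scope ring_scope.

(** * Real sequences and elementary estimates *)

Lemma cvg_sum_nat (R : realType) (u : nat -> nat -> R) (v : nat -> R)
    (k : nat) :
  (forall j, (j < k)%N -> u j n @[n --> \oo] --> v j) ->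
  \sum_(0 <= j < k) u j n @[n --> \oo] --> \sum_(0 <= j < k) v j.
Proof.
elim: k => [|k IH] uv.
  by rewrite big_geq//; under eq_fun do rewrite big_geq//; exact: cvg_cst.
rewrite big_nat_recr//=; under eq_fun do rewrite big_nat_recr//=.
by apply: cvgD; [apply: IH => j jk; apply: uv; exact: ltnW|exact: uv].
Qed.

(** Each step is a convex combination, so once [|delta n| <= e / 2] the level [e / 2] is preserved.
    The excess over it is multiplied by [r n <= expR (- (1 - r n))], hence decays like the
    exponential of minus the divergent partial sums. *)
Lemma relaxation_cvg0 (R : realType) (r D delta : nat -> R) :
  (forall n, 0 <= r n) -> (forall n, r n <= 1) ->
  \sum_(0 <= k < n) (1 - r k) @[n --> \oo] --> +oo ->
  delta n @[n --> \oo] --> (0 : R) ->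
  (forall n, D n.+1 = r n * D n + (1 - r n) * delta n) ->
  D n @[n --> \oo] --> (0 : R).
Proof.
move=> r0 r1 sum_oo delta0 Drec.
set S := fun n => \sum_(0 <= k < n) (1 - r k) in sum_oo.
apply/cvgr0Pnorm_le => e e0.
have e2 : 0 < e / 2 by rewrite divr_gt0.
have /cvgr0Pnorm_le/(_ _ e2)[N _ deltaN] := delta0.
have bound n : (N <= n)%N ->
    `|D n| <= e / 2 + `|D N| * expR (S N) * expR (- S n).
  elim: n => [|n IH].
    rewrite leqn0 => /eqP N0.
    rewrite N0 -mulrA -expRD addrN expR0 mulr1 lerDr; exact: ltW.
  rewrite leq_eqVlt => /orP[/eqP <-|].
    rewrite -mulrA -expRD addrN expR0 mulr1 lerDr; exact: ltW.
  rewrite ltnS => Nn.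
  have := IH Nn; have := deltaN n Nn => /= dn IHn.
  have Sn : S n.+1 = S n + (1 - r n) by rewrite /S big_nat_recr.
  rewrite Drec Sn opprD expRD.
  apply: (le_trans (ler_normD _ _)).
  have r1n : 0 <= 1 - r n by rewrite subr_ge0.
  rewrite !normrM (ger0_norm (r0 n)) (ger0_norm r1n).
  have re : r n <= expR (- (1 - r n)).
    by apply: le_trans (expR_ge1Dx _); rewrite opprB addrC subrK.
  set c := `|D N| * expR (S N) in IHn *.
  have c0 : 0 <= c * expR (- S n) by rewrite !mulr_ge0 ?expR_ge0.
  have h1 := ler_wpM2l (r0 n) IHn.
  have h2 : (1 - r n) * `|delta n| <= (1 - r n) * (e / 2).
    by apply: ler_wpM2l => //; rewrite subr_ge0.
  have h3 := ler_wpM2l c0 re.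
  lra.
have exp0 : `|D N| * expR (S N) * expR (- S n) @[n --> \oo] --> (0 : R).
  rewrite -[0](mulr0 (`|D N| * expR (S N))).
  apply: cvgM; first exact: cvg_cst.
  exact: (cvg_comp _ _ sum_oo (@cvgr_expR R)).
have /cvgr0Pnorm_le/(_ _ e2) := exp0.
move=> [M _ expM].
exists (maxn N M) => // n /=; rewrite geq_max => /andP[Nn Mn].
have := bound n Nn; have := ler_norm (`|D N| * expR (S N) * expR (- S n)).
have := expM n Mn => /=.
lra.
Qed.

(** Follows from [1 - u <= expR (- u) <= 1 / (1 + u) <= 1 - u + u ^+ 2], where the middle inequality
    is [1 + u <= expR u] inverted. *)
Lemma expRN_approx (R : realType) (u : R) : 0 <= u ->
  `|1 - u - expR (- u)| <= u ^+ 2.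
Proof.
move=> u0.
have h1 := expR_ge1Dx (- u).
have h2 := expR_ge1Dx u.
have h3 : expR u * expR (- u) = 1 by rewrite -expRD addrN expR0.
have h4 := expR_gt0 (- u).
rewrite ler_norml; apply/andP; split; last by nra.
have h5 : (1 + u) * expR (- u) <= 1 by rewrite -[leRHS]h3 ler_wpM2r// ltW.
nra.
Qed.

(** * Generating functions and convergence of their coefficients *)

(** From index [k] on, each power of [x] is at most [x ^+ k] and the remaining mass is at most 1. *)
Lemma pgf_remainder (R : realType) (p : nat -> R) (x G : R) (k : nat) :
  (forall j, 0 <= p j) -> series p n @[n --> \oo] --> (1 : R) ->
  0 <= x <= 1 -> series (fun j => p j * x ^+ j) n @[n --> \oo] --> G ->
  0 <= G - \sum_(0 <= j < k) p j * x ^+ j <= x ^+ k.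
Proof.
move=> p0 p1 /andP[x0 x1] pG.
have pnd : nondecreasing_seq (series p).
  by apply/nondecreasing_seqP => n; rewrite /series/= big_nat_recr//= lerDl.
have ple n : series p n <= 1.
  rewrite -(cvg_lim _ p1)//; apply: nondecreasing_cvgn_le => //.
  by apply/cvg_ex; exists 1.
have pk n : (k <= n)%N -> 0 <= series (fun j => p j * x ^+ j) n -
    \sum_(0 <= j < k) p j * x ^+ j <= x ^+ k.
  move=> kn; rewrite /series/= (big_cat_nat (n := k))//= addrAC subrr add0r.
  apply/andP; split.
    by apply: sumr_ge0 => j _; rewrite mulr_ge0// exprn_ge0.
  apply: (@le_trans _ _ (\sum_(k <= j < n) p j * x ^+ k)).
    rewrite !big_nat; apply: ler_sum => j /andP[kj _].
    by rewrite ler_wpM2l// ler_wiXn2l.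
  rewrite -mulr_suml ler_piMl ?exprn_ge0//.
  apply: le_trans (ple n); rewrite /series/= [leRHS](big_cat_nat (n := k))//=.
  by rewrite lerDr sumr_ge0.
have cvgG : series (fun j => p j * x ^+ j) n - \sum_(0 <= j < k) p j * x ^+ j
    @[n --> \oo] --> G - \sum_(0 <= j < k) p j * x ^+ j.
  by apply: cvgB => //; exact: cvg_cst.
apply/andP; split.
  by apply: (cvgr_to_ge cvgG) => //; exists k => // n /= /pk /andP[].
by apply: (cvgr_to_le cvgG) => //; exists k => // n /= /pk /andP[].
Qed.

(** Strong induction on [k]: once the lower coefficients converge, subtracting their terms isolates
    the [k]-th one up to a tail of higher order in [x]. Stating the hypotheses as remainder bounds
    covers both the polynomials [G n] and the entire function [H]. *)
Lemma pgf_cvg_pmf (R : realType) (p : nat -> nat -> R) (q : nat -> R)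
    (G : nat -> R -> R) (H : R -> R) :
  (forall n k x, 0 <= x <= 1 ->
     0 <= G n x - \sum_(0 <= j < k) p n j * x ^+ j <= x ^+ k) ->
  (forall k x, 0 <= x <= 1 ->
     0 <= H x - \sum_(0 <= j < k) q j * x ^+ j <= x ^+ k) ->
  (forall x, 0 <= x <= 1 -> G n x @[n --> \oo] --> H x) ->
  forall k, p n k @[n --> \oo] --> q k.
Proof.
move=> hG hH GH; elim/ltn_ind => k IH.
apply/cvgrPdist_le => e e0.
(* The terms beyond [k] contribute at most [x ^+ k.+1], which is negligible
   with respect to [x ^+ k] for small [x]. *)
set x := Num.min 1 (e / 2).
have x0 : 0 < x by rewrite lt_min ltr01 divr_gt0.
have x01 : 0 <= x <= 1 by rewrite ltW//= ge_min lexx.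
have xe : x <= e / 2 by rewrite ge_min lexx orbT.
have low : (G n x - H x) - \sum_(0 <= j < k) (p n j - q j) * x ^+ j
    @[n --> \oo] --> (0 : R).
  rewrite -[X in _ --> X](subrr 0); apply: cvgB.
    by rewrite -(subrr (H x)); apply: cvgB; [exact: GH|exact: cvg_cst].
  rewrite [X in _ --> X](_ : 0 = \sum_(0 <= j < k) (0 : R)); last first.
    by rewrite big1.
  apply: (@cvg_sum_nat _ (fun j n => (p n j - q j) * x ^+ j) (fun=> 0)) => j jk.
  rewrite -(mul0r (x ^+ j)) -(subrr (q j)).
  by apply: cvgM; [apply: cvgB; [exact: IH|exact: cvg_cst]|exact: cvg_cst].
have xk0 : 0 < x ^+ k * (e / 2) by rewrite mulr_gt0 ?exprn_gt0// divr_gt0.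
have /cvgr0Pnorm_le/(_ _ xk0) := low.
move=> [N _ hN]; exists N => // n /= Nn.
have {hN} := hN n Nn; rewrite /= => hN.
have := hG n k.+1 x x01; have := hH k.+1 x x01.
rewrite !big_nat_recr//= exprS.
have split_sum : \sum_(0 <= j < k) (p n j - q j) * x ^+ j =
    \sum_(0 <= j < k) p n j * x ^+ j - \sum_(0 <= j < k) q j * x ^+ j.
  by rewrite -sumrB; apply: eq_bigr => j _; rewrite mulrBl.
rewrite split_sum in hN.
set a := \sum_(0 <= j < k) p n j * x ^+ j in hN *.
set b := \sum_(0 <= j < k) q j * x ^+ j in hN *.
have xk : 0 < x ^+ k by rewrite exprn_gt0.
have xxe : x * x ^+ k <= e / 2 * x ^+ k by rewrite ler_wpM2r// ltW.
move: hN; rewrite ler_norml => /andP[h1 h2] /andP[h3 h4] /andP[h5 h6].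
(* Both tails lie between 0 and [x ^+ k.+1], so their difference costs only
   [x * x ^+ k <= e / 2 * x ^+ k]; the lower terms take the other half of [e * x ^+ k]. *)
rewrite -(ler_pM2r xk) -[X in `|_| * X](gtr0_norm xk) -normrM ler_norml.
by rewrite mulrBl; apply/andP; split; lra.
Qed.

(** * Generating functions of the Poisson law and of the process *)

Lemma cvg_series_poly (R : realType) (Q : {poly R}) (x : R) :
  series (fun j => Q`_j * x ^+ j) n @[n --> \oo] --> Q.[x].
Proof.
apply: (@cvg_near_cst _ _ _ _ \oo).
exists (size Q) => // n /= Qn.
by rewrite (horner_coef_wide _ Qn) /series/= big_mkord.
Qed.

Lemma poisson_pgf (R : realType) (lambda x : R) :
  series (fun j => lambda ^+ j / j`!%:R * expR (- lambda) * x ^+ j) n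
    @[n --> \oo] --> expR (- (lambda * (1 - x))).
Proof.
have -> : - (lambda * (1 - x)) = lambda * x + - lambda by ring.
rewrite expRD.
rewrite (_ : series _ = (fun n => series (exp_coeff (lambda * x)) n *
  expR (- lambda))).
  by apply: cvgM; [exact: is_cvg_series_exp_coeff|exact: cvg_cst].
apply/funext => n; rewrite /series/= mulr_suml; apply: eq_bigr => j _.
by rewrite exp_coeffE exprMn; ring.
Qed.

(** A polynomial serves two purposes: its coefficients are point masses, and its values enter the
    analytic recursion. *)
Definition bernoulli_pgf (R : realType) (r : R) : {poly R} :=
  (1 - r)%:P + r *: 'X.

Lemma horner_bernoulli_pgf (R : realType) (r x : R) :
  (bernoulli_pgf r).[x] = 1 - r * (1 - x).
Proof. by rewrite /bernoulli_pgf !hornerE; ring. Qed.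

(* Thinning with success probability [r n] composes the generating function
   with that of a Bernoulli variable; immigration multiplies it. *)
Fixpoint INAR1_pgf (R : realType) (r m : nat -> R) (n : nat) : {poly R} :=
  if n is n'.+1 then
    (INAR1_pgf r m n' \Po bernoulli_pgf (r n')) * bernoulli_pgf (m n')
  else 1.

Lemma INAR1_pgf_1 (R : realType) (r m : nat -> R) (n : nat) :
  (INAR1_pgf r m n).[1] = 1.
Proof.
elim: n => [|n IH]/=; first by rewrite hornerC.
rewrite hornerM horner_comp !horner_bernoulli_pgf subrr !mulr0 subr0 IH.
by rewrite mulr1.
Qed.

Lemma INAR1_pgf_cvg (R : realType) (r m : nat -> R) (lambda x : R) :
  (forall n, 0 <= r n < 1) -> (forall n, 0 <= m n <= 1) -> 0 <= lambda ->
  r n @[n --> \oo] --> (1 : R) ->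
  \sum_(0 <= k < n) (1 - r k) @[n --> \oo] --> +oo ->
  m n / (1 - r n) @[n --> \oo] --> lambda -> 0 <= x <= 1 ->
  (INAR1_pgf r m n).[x] @[n --> \oo] --> expR (- (lambda * (1 - x))).
Proof.
move=> r01 m01 l0 r1 sum_oo ratio x01.
(* The two terms are the errors of replacing [m n] by [lambda * (1 - r n)] and then [1 - v] by
   [expR (- v)], after division by [(1 - r n) * (1 - y)]. *)
pose delta n := `|m n / (1 - r n) - lambda| + lambda ^+ 2 * (1 - r n).
(* The initial value [lambda] comes from [1 - expR (- u) <= u] with [u = lambda * (1 - y)], since
   the generating function of [X_0 = 0] is 1. *)
pose D := fix D n :=
  if n is n'.+1 then r n' * D n' + (1 - r n') * delta n' else lambda.
have delta0 : delta n @[n --> \oo] --> (0 : R).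
  have -> : 0 = `|lambda - lambda| + lambda ^+ 2 * (1 - 1) :> R.
    by rewrite !subrr normr0 mulr0 addr0.
  apply: cvgD.
    by apply: cvg_norm; apply: cvgB => //; exact: cvg_cst.
  by apply: cvgM; [exact: cvg_cst|apply: cvgB => //; exact: cvg_cst].
have D0 : D n @[n --> \oo] --> (0 : R).
  apply: (relaxation_cvg0 (r := r) (delta := delta)) => //.
  - by move=> n; have /andP[] := r01 n.
  - by move=> n; have /andP[_ /ltW] := r01 n.
(* [z] is the point at which the recursion evaluates the previous generating
   function; it contracts the distance to 1 by [r n]. *)
have bound n y : 0 <= y <= 1 ->
    `|(INAR1_pgf r m n).[y] - expR (- (lambda * (1 - y)))| <= D n * (1 - y).
  elim: n y => [|n IH] y /andP[y0 y1] /=.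
    have u0 : 0 <= lambda * (1 - y) by rewrite mulr_ge0 ?subr_ge0.
    have := expR_ge1Dx (- (lambda * (1 - y))).
    have : expR (- (lambda * (1 - y))) <= 1 by rewrite expR_le1 oppr_le0.
    by rewrite hornerC => e1 e2; rewrite ler_norml; apply/andP; split; lra.
  rewrite hornerM horner_comp !horner_bernoulli_pgf.
  have /andP[rn0 rn1] := r01 n; have /andP[mn0 mn1] := m01 n.
  set z := 1 - r n * (1 - y).
  have z01 : 0 <= z <= 1 by rewrite /z; apply/andP; split; nra.
  have {IH} := IH z z01.
  set A := (INAR1_pgf r m n).[z]; set C := expR (- (lambda * (1 - z))).
  set v := lambda * (1 - r n) * (1 - y) => IH.
  have v0 : 0 <= v by rewrite !mulr_ge0 ?subr_ge0// ltW.
  (* The limit obeys the same recursion with immigration factor [expR (- v)]: [lambda * (1 - y)]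
     splits into [lambda * (1 - z)] and [v]. *)
  have -> : expR (- (lambda * (1 - y))) = C * expR (- v).
    by rewrite -expRD; congr expR; rewrite /v /z; ring.
  have C1 : `|C| <= 1.
    rewrite ger0_norm ?expR_ge0// expR_le1 oppr_le0 mulr_ge0//.
    by rewrite subr_ge0; have /andP[] := z01.
  have B1 : `|1 - m n * (1 - y)| <= 1.
    by rewrite ger0_norm; nra.
  have mE : m n - lambda * (1 - r n) =
      (m n / (1 - r n) - lambda) * (1 - r n).
    by rewrite mulrBl divfK// subr_eq0 gt_eqF.
  have step : `|1 - m n * (1 - y) - expR (- v)| <=
      (1 - r n) * delta n * (1 - y).
    have -> : 1 - m n * (1 - y) - expR (- v) =
      (1 - v - expR (- v)) - (m n - lambda * (1 - r n)) * (1 - y).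
      by rewrite /v; ring.
    apply: (le_trans (ler_normB _ _)).
    rewrite mE !normrM (@ger0_norm _ (1 - r n)) ?subr_ge0 ?(ltW rn1)//.
    rewrite (@ger0_norm _ (1 - y)) ?subr_ge0//.
    (* One factor [1 - y] is given up so that the error is linear in [1 - y], as the bound to be
       propagated is. *)
    have v2 : v ^+ 2 <= lambda ^+ 2 * (1 - r n) ^+ 2 * (1 - y).
      have y2 : (1 - y) ^+ 2 <= 1 - y by rewrite expr2 ler_piMl; lra.
      by rewrite /v !exprMn ler_wpM2l// mulr_ge0 ?sqr_ge0.
    have := expRN_approx v0; rewrite /delta; lra.
  have -> : A * (1 - m n * (1 - y)) - C * expR (- v) =
     (A - C) * (1 - m n * (1 - y)) + C * (1 - m n * (1 - y) - expR (- v)).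
    by ring.
  apply: (le_trans (ler_normD _ _)); rewrite !normrM.
  have zE : 1 - z = r n * (1 - y) by rewrite /z; ring.
  rewrite zE in IH.
  have t1 : `|A - C| * `|1 - m n * (1 - y)| <= `|A - C| by rewrite ler_piMr.
  have t2 : `|C| * `|1 - m n * (1 - y) - expR (- v)| <=
    `|1 - m n * (1 - y) - expR (- v)| by rewrite ler_piMl.
  lra.
apply/cvgrPdist_le => e e0.
have /cvgr0Pnorm_le/(_ _ e0)[N _ hN] := D0.
exists N => // n /= /hN /= Dn; have := bound n x x01.
rewrite distrC => /le_trans; apply.
have /andP[x0 x1] := x01.
apply: le_trans Dn; apply: (le_trans (ler_norm _)); rewrite normrM.
rewrite ler_piMr// ger0_norm ?subr_ge0//; lra.
Qed.

(** * From point masses to expectations of bounded functions *)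

Lemma bounded_comp_Lfun1 (d : measure_display) (T : measurableType d)
    (R : realType) (P : probability T R) (Y : {RV P >-> nat})
    (h : nat -> R) (M : R) :
  (forall k, `|h k| <= M) -> h \o Y \in Lfun P 1.
Proof.
move=> hM; apply/Lfun1_integrable.
apply: (@le_integrable _ _ _ P setT _ _ (EFin \o cst M)) => //.
- apply/measurable_EFinP.
  exact: measurableT_comp.
- by move=> w _ /=; rewrite lee_fin (le_trans (hM _))// ler_norm.
- exact: finite_measure_integrable_cst.
Qed.

(** A truncated function of [Y] is a finite combination of indicators of the events [Y = k], so
    linearity suffices. *)
Lemma expectation_truncated (d : measure_display) (T : measurableType d)
    (R : realType) (P : probability T R) (Y : {RV P >-> nat})
    (p f : nat -> R) (M : R) (K : nat) :
  (forall k, P (Y @^-1` [set k]) = (p k)%:E) -> (forall k, `|f k| <= M) ->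
  ('E_P[(fun k => if (k < K)%N then f k else 0%R) \o Y])%E =
  (\sum_(0 <= k < K) f k * p k)%:E.
Proof.
move=> pE fM; have M0 : 0 <= M := le_trans (normr_ge0 _) (fM 0%N).
elim: K => [|K IH]; first by rewrite big_geq// (expectation_cst P 0).
rewrite (_ : _ \o _ = ((fun k => if (k < K)%N then f k else 0) \o Y) \+
    (f K \o* \1_(Y @^-1` [set K]))); last first.
  apply/funext => w /=; rewrite indicE ltnS leq_eqVlt.
  case: eqVneq => [YK|YK] /=.
    by rewrite YK ltnn mem_set// add0r mul1r.
  by rewrite memNset ?mul0r ?addr0// => /eqP; rewrite (negbTE YK).
have mYK : measurable (Y @^-1` [set K]) by exact: measurable_funPTI.
have LK : (\1_(Y @^-1` [set K]) : T -> R) \in Lfun P 1.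
  apply: (@bounded_comp_Lfun1 _ _ _ P Y \1_[set K] 1) => k.
  by rewrite indicE normr_nat lern1 leq_b1.
rewrite expectationD ?expectationZl ?expectation_indic//.
- by rewrite IH pE -EFinM -EFinD big_nat_recr.
- apply: (@bounded_comp_Lfun1 _ _ _ P Y _ M) => k; case: ifP => // _.
  by rewrite normr0.
- exact: (@Lfun_scale _ _ _ P _ _ 1).
Qed.

(** Pointwise, [f] differs from its truncation by at most [M] on [Y >= K] and not at all elsewhere;
    this is then integrated. *)
Lemma expectation_tail (d : measure_display) (T : measurableType d)
    (R : realType) (P : probability T R) (Y : {RV P >-> nat})
    (p f : nat -> R) (M : R) (K : nat) :
  (forall k, P (Y @^-1` [set k]) = (p k)%:E) -> (forall k, `|f k| <= M) ->
  `|fine ('E_P[f \o Y])%E - \sum_(0 <= k < K) f k * p k| <=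
  M * (1 - \sum_(0 <= k < K) p k).
Proof.
move=> pE fM; have M0 : 0 <= M := le_trans (normr_ge0 _) (fM 0%N).
set trunc := fun (g : nat -> R) k => if (k < K)%N then g k else 0.
have truncM g c : 0 <= c -> (forall k, `|g k| <= c) ->
    forall k, `|trunc g k| <= c.
  by move=> c0 gc k; rewrite /trunc; case: ifP => // _; rewrite normr0.
pose one : nat -> R := cst 1.
have L1 : one \o Y \in Lfun P 1.
  by apply: (@bounded_comp_Lfun1 _ _ _ P Y _ 1) => k; rewrite normr1.
have Lt1 : trunc one \o Y \in Lfun P 1.
  by apply: (@bounded_comp_Lfun1 _ _ _ P Y _ 1); apply: truncM => // k;
    rewrite normr1.
(* This is the indicator of [Y >= K], written so that its expectation reduces to that of a truncated
   constant. *)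
pose h1 := (one \o Y) \- (trunc one \o Y).
pose hf := (f \o Y) \- (trunc f \o Y).
have Lf := bounded_comp_Lfun1 Y fM.
have Lt : trunc f \o Y \in Lfun P 1 := bounded_comp_Lfun1 Y (truncM _ _ M0 fM).
rewrite -lee_fin -abse_EFin.
have -> : (fine ('E_P[f \o Y])%E - \sum_(0 <= k < K) f k * p k)%:E =
    ('E_P[hf])%E.
  rewrite expectationB// (expectation_truncated _ pE fM) EFinB fineK//.
  exact: expectation_fin_num.
have -> : (M * (1 - \sum_(0 <= k < K) p k))%:E =
    ('E_P[M \o* h1])%E.
  rewrite expectationZl; last first.
    apply: (@bounded_comp_Lfun1 _ _ _ P Y (one \- trunc one) 1) => k.
    by rewrite /trunc/=; case: ifP; rewrite ?subrr ?subr0 ?normr0 ?normr1.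
  rewrite expectationB//.
  rewrite (@expectation_truncated _ _ _ P Y p one 1)//; last first.
    by move=> k; rewrite normr1.
  rewrite (expectation_cst P 1) EFinM EFinB.
  by congr (_ * (_ - _%:E))%E; apply: eq_bigr => k _; rewrite mul1r.
have mf : measurable_fun setT (EFin \o hf).
  by apply/measurable_EFinP;
    apply: (@measurableT_comp _ _ _ _ _ _ (f \- trunc f)).
have m1 : measurable_fun setT (EFin \o (M \o* h1)).
  apply/measurable_EFinP.
  by apply: (@measurableT_comp _ _ _ _ _ _ (M \o* (one \- trunc one))).
rewrite unlock; apply: (le_trans (le_abse_integral _ _ mf)) => //.
apply: ge0_le_integral => //.
- exact: measurableT_comp.
- move=> w _ /=; rewrite lee_fin /hf /h1 /trunc/=; case: ifP => _ /=.
    by rewrite !subrr normr0 mul0r.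
  by rewrite !subr0 mul1r.
Qed.

(** Tightness comes from [q] having total mass 1: the tail of [p n] beyond [K] is 1 minus a finite
    sum, so it converges to the small tail of [q]. *)
Lemma nat_pmf_cvg_expectation (d d' : measure_display) (T : measurableType d)
    (T' : measurableType d') (R : realType) (P : probability T R)
    (P' : probability T' R) (Y : nat -> {RV P >-> nat}) (Z : {RV P' >-> nat})
    (p : nat -> nat -> R) (q f : nat -> R) (M : R) :
  (forall n k, P (Y n @^-1` [set k]) = (p n k)%:E) ->
  (forall k, P' (Z @^-1` [set k]) = (q k)%:E) ->
  series q n @[n --> \oo] --> (1 : R) ->
  (forall k, p n k @[n --> \oo] --> q k) -> (forall k, `|f k| <= M) ->
  ('E_P[f \o Y n])%E @[n --> \oo] --> ('E_P'[f \o Z])%E.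
Proof.
move=> pE qE q1 pq fM; have M0 : 0 <= M := le_trans (normr_ge0 _) (fM 0%N).
have finY n : ('E_P[f \o Y n])%E \is a fin_num.
  exact/expectation_fin_num/(bounded_comp_Lfun1 _ fM).
have finZ : ('E_P'[f \o Z])%E \is a fin_num.
  exact/expectation_fin_num/(bounded_comp_Lfun1 _ fM).
rewrite -(fineK finZ); apply/fine_cvgP; split; first by exists 0%N.
apply/cvgrPdist_le => e e0.
(* Dividing by [M + 1] rather than [M] covers [M = 0]. *)
have e3 : 0 < e / (3 * (M + 1)) by rewrite divr_gt0// mulr_gt0// ltr_wpDl.
have /cvgrPdist_le/(_ _ e3)[K _ hK] := q1.
have {hK}q3 := le_trans (ler_norm _) (hK K (leqnn K)).
have Mq3 : M * (1 - \sum_(0 <= k < K) q k) <= e / 3.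
  apply: (le_trans (ler_wpM2l M0 q3)).
  have M1 : 0 < M + 1 by rewrite ltr_wpDl.
  have -> : M * (e / (3 * (M + 1))) = e / 3 * (M / (M + 1)).
    by field; rewrite gt_eqF.
  rewrite ler_piMr ?divr_ge0 ?(ltW e0)//.
  by rewrite ler_pdivrMr// mul1r lerDl.
(* This quantity has a limit at most [e / 3], hence is eventually at most [2 * e / 3]; the tail of
   [Z] takes the last third. *)
have bound : M * (1 - \sum_(0 <= k < K) p n k) +
    `|\sum_(0 <= k < K) f k * p n k - \sum_(0 <= k < K) f k * q k| @[n --> \oo]
    --> M * (1 - \sum_(0 <= k < K) q k) + 0.
  apply: cvgD.
    apply: cvgM; first exact: cvg_cst.
    apply: cvgB; first exact: cvg_cst.
    by apply: (@cvg_sum_nat _ (fun k n => p n k)) => k _; exact: pq.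
  rewrite -[X in _ --> X](@normr0 R R); apply: cvg_norm.
  rewrite -[X in _ --> X](subrr (\sum_(0 <= k < K) f k * q k)).
  apply: cvgB; last exact: cvg_cst.
  apply: (@cvg_sum_nat _ (fun k n => f k * p n k)) => k _.
  by apply: cvgM; [exact: cvg_cst|exact: pq].
have e3' : M * (1 - \sum_(0 <= k < K) q k) + 0 < e / 3 + e / 3.
  by rewrite addr0; apply: (le_lt_trans Mq3); rewrite ltrDl divr_gt0.
have [N _ hN] := cvgr_le _ bound _ e3'.
exists N => // n /= /hN /= {hN}hN.
have hY := expectation_tail K (pE n) fM; have hZ := expectation_tail K qE fM.
move: hY hZ hN Mq3; rewrite /=.
set a := fine _; set b := \sum_(0 <= k < K) f k * p n k.
set a' := fine _; set b' := \sum_(0 <= k < K) f k * q k => hY hZ hN Mq3.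
have -> : a' - a = (a' - b') - (a - b) - (b - b') by ring.
apply: (le_trans (ler_normB _ _)); have := ler_normB (a' - b') (a - b).
lra.
Qed.

(** * Independence and sums of independent variables *)

Lemma eseries_finite (R : realType) (u : nat -> R) (N : nat) :
  (forall n, (N <= n)%N -> u n = 0) ->
  (\sum_(0 <= n <oo) (u n)%:E)%E = (\sum_(n < N) u n)%:E.
Proof.
move=> uN; apply: lim_near_cst => //.
exists N => // n /= Nn; rewrite sumEFin (big_cat_nat (n := N))//=.
rewrite [X in _ + X]big_nat_cond [X in _ + X]big1 ?addr0 ?big_mkord//.
by move=> i /andP[/andP[Ni _] _]; exact: uN.
Qed.

(* The event [A] is independent of the subfamily of [Y] indexed by [J], whose
   members are moreover mutually independent (up to the factor [P A]). *)
Definition indep_event (d : measure_display) (T : measurableType d)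
    (R : realType) (P : probability T R) (I : choiceType) (J : set I)
    (Y : I -> {RV P >-> nat}) (A : set T) : Prop :=
  measurable A /\ forall (F : {fset I}) (B : I -> set nat), [set` F] `<=` J ->
    P (A `&` \bigcap_(i in [set` F]) (Y i @^-1` B i)) =
    (P A * \prod_(i <- F) P (Y i @^-1` B i))%E.

Lemma indep_event_setT (d : measure_display) (T : measurableType d)
    (R : realType) (P : probability T R) (I : choiceType) (J : set I)
    (Y : I -> {RV P >-> nat}) :
  mutually_independent P J Y -> indep_event J Y setT.
Proof.
move=> ind; split=> // F B FJ.
by rewrite setTI probability_setT mul1e; exact: ind.
Qed.

Lemma indep_event_set0 (d : measure_display) (T : measurableType d)
    (R : realType) (P : probability T R) (I : choiceType) (J : set I)
    (Y : I -> {RV P >-> nat}) :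
  indep_event J Y set0.
Proof. by split=> // F B _; rewrite set0I measure0 mul0e. Qed.

Lemma indep_eventS (d : measure_display) (T : measurableType d)
    (R : realType) (P : probability T R) (I : choiceType) (J K : set I)
    (Y : I -> {RV P >-> nat}) (A : set T) :
  J `<=` K -> indep_event K Y A -> indep_event J Y A.
Proof.
by move=> JK [mA ind]; split=> // F B FJ; apply: ind; exact: subset_trans JK.
Qed.

(** Conditioning on [Y i] uses up the index [i]. The product formula is applied to [F] enlarged by
    [i], with [B] overridden at [i] by [S], which is harmless because [i] is outside [F]. *)
Lemma indep_event_setI (d : measure_display) (T : measurableType d)
    (R : realType) (P : probability T R) (I : choiceType) (J : set I)
    (Y : I -> {RV P >-> nat}) (A : set T) (i : I) (S : set nat) :
  indep_event J Y A -> J i ->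
  indep_event (J `\ i) Y (A `&` Y i @^-1` S) /\
  P (A `&` Y i @^-1` S) = (P A * P (Y i @^-1` S))%E.
Proof.
move=> [mA ind] Ji.
have mYS : measurable (Y i @^-1` S) by exact: measurable_funPTI.
have PAS : P (A `&` Y i @^-1` S) = (P A * P (Y i @^-1` S))%E.
  have := ind [fset i]%fset (fun=> S).
  rewrite big_seq_fset1 set_fset1 bigcap_set1; apply.
  by move=> j ->.
split=> //; split=> [|F B FJ]; first exact: measurableI.
have iF : i \notin F.
  by apply/negP => /FJ[_]; exact.
pose B' j := if j == i then S else B j.
have BF j : j \in F -> B' j = B j.
  by move=> jF; rewrite /B' ifN//; apply: contraNneq iF => <-.
have := ind (i |` F)%fset B'.
rewrite big_fsetU1//=.
rewrite [X in (P A * (X * _))%E](_ : _ = P (Y i @^-1` S)); last first.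
  by rewrite /B' eqxx.
rewrite (_ : \bigcap_(j in [set` (i |` F)%fset]) (Y j @^-1` B' j) =
  Y i @^-1` S `&` \bigcap_(j in [set` F]) (Y j @^-1` B j)); last first.
  rewrite set_fsetU1 bigcap_setU1 {1}/B' eqxx; congr (_ `&` _).
  by apply: eq_bigcapr => j jF; rewrite BF.
rewrite setIA PAS -muleA => ->; last first.
  by move=> j /=; rewrite in_fset1U => /orP[/eqP ->//|/FJ[]].
congr (_ * (_ * _))%E; rewrite big_seq [RHS]big_seq.
by apply: eq_bigr => j jF; rewrite BF.
Qed.

(** Countable additivity sums the product formulas of the disjoint pieces; this reassembles an event
    split by the value of a variable. *)
Lemma indep_event_bigcup (d : measure_display) (T : measurableType d)
    (R : realType) (P : probability T R) (I : choiceType) (J : set I)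
    (Y : I -> {RV P >-> nat}) (A : nat -> set T) :
  trivIset setT A -> (forall n, indep_event J Y (A n)) ->
  indep_event J Y (\bigcup_n A n).
Proof.
move=> tA indA; have mA n : measurable (A n) by case: (indA n).
split=> [|F B FJ]; first exact: bigcup_measurable.
have mC : measurable (\bigcap_(i in [set` F]) (Y i @^-1` B i)).
  by apply: fin_bigcap_measurable => // i _; exact: measurable_funPTI.
rewrite setI_bigcupl measure_bigcup//=; last 2 first.
- by move=> n _; exact: measurableI.
- exact: trivIset_setIr.
rewrite measure_bigcup// muleC.
have prod_fin : (\prod_(i <- F) P (Y i @^-1` B i))%E \is a fin_num.
  rewrite prode_fin_num// => i _; apply: fin_num_measure.
  exact: measurable_funPTI.
rewrite -(fineK prod_fin) -nneseriesZl//.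
apply: eq_eseriesr => n _; case: (indA n) => _ /(_ F B FJ) /= ->.
by rewrite fineK// muleC.
Qed.

(** Convolution becomes multiplication of polynomials. The induction splits on the value [a] of the
    head variable, moving [a] from the sum into the offset [c], tracked by ['X^c], while [A] absorbs
    the event that fixes this value. *)
Lemma indep_event_sum (d : measure_display) (T : measurableType d)
    (R : realType) (P : probability T R) (I : choiceType) (J : set I)
    (Y : I -> {RV P >-> nat}) (A : set T) (pA : R) (s : seq I)
    (q : I -> {poly R}) (c l : nat) :
  uniq s -> [set` s] `<=` J ->
  (forall i k, i \in s -> P (Y i @^-1` [set k]) = ((q i)`_k)%:E) ->
  indep_event J Y A -> P A = pA%:E ->
  let E := A `&` [set w | c + \sum_(i <- s) Y i w = l]%N in
  indep_event (J `\` [set` s]) Y E /\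
  P E = (pA * ('X^c * \prod_(i <- s) q i)`_l)%:E.
Proof.
elim: s J A pA c => [|i s IH] J A pA c /=.
  move=> _ _ _ indA PA.
  have -> : [set w | c + \sum_(i <- [::]) Y i w = l]%N = [set _ | c = l].
    by apply/seteqP; split=> w /=; rewrite big_nil addn0.
  rewrite big_nil mulr1 coefXn; case: eqVneq => [->|lc].
    rewrite (_ : [set _ | c = c] = setT); last by apply/seteqP.
    rewrite setIT mulr1; split=> //; apply: indep_eventS indA.
    exact: subDsetl.
  rewrite (_ : [set _ | c = l] = set0); last first.
    by apply/seteqP; split=> // w /= cl; rewrite cl eqxx in lc.
  by rewrite setI0 measure0 mulr0; split=> //; exact: indep_event_set0.
move=> /andP[si us] sJ qE indA PA.
have Ji : J i by apply: sJ; rewrite /= mem_head.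
have IHa a := @IH (J `\ i)
  (A `&` Y i @^-1` [set a]) (pA * (q i)`_a) (c + a)%N us.
have {IHa}IHa a : let E := A `&` Y i @^-1` [set a] `&`
      [set w | c + a + \sum_(j <- s) Y j w = l]%N in
    indep_event (J `\` [set` i :: s]) Y E /\
    P E = (pA * (q i)`_a * ('X^(c + a) * \prod_(j <- s) q j)`_l)%:E.
  have [indAa PAa] := indep_event_setI [set a] indA Ji.
  have [] := IHa a.
  - move=> j /= js; split; first by apply: sJ; rewrite /= in_cons js orbT.
    by move=> /= ji; rewrite -ji js in si.
  - by move=> j k js; apply: qE; rewrite in_cons js orbT.
  - exact: indAa.
  - by rewrite PAa PA qE ?mem_head// -EFinM.
  move=> indE PE; split=> //; apply: indep_eventS indE.
  move=> j [Jj]; rewrite /= in_cons => /negP; rewrite negb_or => /andP[ji js].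
  by split; [split=> //; exact/eqP|exact/negP].
set E := fun a => A `&` Y i @^-1` [set a] `&`
      [set w | c + a + \sum_(j <- s) Y j w = l]%N.
have -> : A `&` [set w | c + \sum_(j <- i :: s) Y j w = l]%N = \bigcup_a E a.
  apply/seteqP; split=> w.
    by move=> [Aw] /=; rewrite big_cons addnA => h; exists (Y i w).
  by move=> [a _ [[Aw /= <-] h]]; split=> //=; rewrite big_cons addnA.
have tE : trivIset setT E.
  by apply/trivIsetP => a b _ _ ab; apply/seteqP; split=> // w;
    move=> [[[_ /= ya] _] [[_ /= yb] _]]; rewrite -ya -yb eqxx in ab.
split; first by apply: indep_event_bigcup => // a; exact: (IHa a).1.
have mE a : measurable (E a) by have [[]] := IHa a.
rewrite measure_semi_bigcup//; last exact: bigcup_measurable.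
rewrite (eq_eseriesr (fun a _ => (IHa a).2)).
rewrite (@eseries_finite _ (fun a => pA * (q i)`_a *
  ('X^(c + a) * \prod_(j <- s) q j)`_l) (size (q i))); last first.
  by move=> a /(nth_default 0) ->; rewrite mulr0 mul0r.
(* Expanding only the head polynomial into monomials matches the split by the value [a]. *)
rewrite big_cons -[q i in RHS]coefK poly_def.
rewrite mulr_suml mulr_sumr coef_sum mulr_sumr.
congr _%:E; apply: eq_bigr => a _.
by rewrite -(scalerAl (q i)`_a) -(scalerAr (q i)`_a) coefZ exprD !mulrA.
Qed.

(** * Bernoulli variables and the law of the process *)

Lemma coef_bernoulli_pgf (R : realType) (r : R) (k : nat) :
  (bernoulli_pgf r)`_k =
  if k is k'.+1 then (if k' is 0%N then r else 0) else 1 - r.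
Proof.
rewrite /bernoulli_pgf coefD coefC coefZ coefX.
by case: k => [|[|k]] /=; rewrite ?mulr0 ?mulr1 ?addr0 ?add0r.
Qed.

(** Almost surely [Y] equals the indicator of [Y = 1], so its mean is the mass at 1; the mass at 0
    is the complement and all others vanish. *)
Lemma bernoulli_pmf (d : measure_display) (T : measurableType d) (R : realType)
    (P : probability T R) (Y : {RV P >-> nat}) (r : R) :
  P (Y @^-1` [set 0%N; 1%N]) = 1%E -> ('E_P[@real_of_nat R \o Y])%E = r%:E ->
  forall k, P (Y @^-1` [set k]) = ((bernoulli_pgf r)`_k)%:E.
Proof.
move=> P01 Er.
have mY k : measurable (Y @^-1` [set k]) by exact: measurable_funPTI.
have m01 : measurable (Y @^-1` [set 0%N; 1%N]) by exact: measurable_funPTI.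
have P01C : P (~` (Y @^-1` [set 0%N; 1%N])) = 0%E.
  by rewrite probability_setC// P01 subee.
have P1 : P (Y @^-1` [set 1%N]) = r%:E.
  rewrite -Er -(expectation_indic P (mY 1%N)) unlock.
  apply: ge0_ae_eq_integral => //.
  - by apply/measurable_EFinP; exact: measurable_indic.
  - by apply/measurable_EFinP; exact: measurableT_comp.
  - by move=> w _; rewrite lee_fin /= /real_of_nat.
  - exists (~` (Y @^-1` [set 0%N; 1%N])); split=> //; first exact: measurableC.
    apply: subsetC => w /= Yw _; congr _%:E; rewrite indicE /real_of_nat.
    by case: Yw => Yw; [rewrite memNset /= Yw|rewrite mem_set /= ?Yw].
case=> [|[|k]]; rewrite coef_bernoulli_pgf//.
  have : (P (Y @^-1` [set 0%N]) + P (Y @^-1` [set 1%N]) = 1)%E.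
    rewrite -P01 preimage_setU measureU//.
    by apply/seteqP; split=> // w [/= ->].
  rewrite P1; have := fin_num_measure P _ (mY 0%N).
  by case: (P _) => // x _ [<-]; rewrite addrK.
apply/eqP; rewrite -measure_le0 -P01C le_measure ?inE//.
  exact: measurableC.
by move=> w /= -> [].
Qed.

Lemma bernoulli_mean01 (d : measure_display) (T : measurableType d)
    (R : realType) (P : probability T R) (Y : {RV P >-> nat}) (r : R) :
  P (Y @^-1` [set 0%N; 1%N]) = 1%E -> ('E_P[@real_of_nat R \o Y])%E = r%:E ->
  0 <= r <= 1.
Proof.
move=> P01 Er; have := bernoulli_pmf P01 Er 1; rewrite coef_bernoulli_pgf => P1.
have mY : measurable (Y @^-1` [set 1%N]) by exact: measurable_funPTI.
by rewrite -!lee_fin -P1 measure_ge0 probability_le1.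
Qed.

(** The induction also carries the independence of the event [X n = k] from all later innovations.
    On that event the number of offspring terms is the constant [k], so the law of a sum of fixed
    length applies. *)
Lemma INAR1_law (d : measure_display) (T : measurableType d) (R : realType)
    (P : probability T R) (xi : nat -> nat -> {RV P >-> nat})
    (eps X : nat -> {RV P >-> nat}) (r m : nat -> R) :
  inhomogeneous_INAR1 P xi eps X ->
  (forall n j k, (0 < j)%N ->
    P (xi n.+1 j @^-1` [set k]) = ((bernoulli_pgf (r n))`_k)%:E) ->
  (forall n k, P (eps n.+1 @^-1` [set k]) = ((bernoulli_pgf (m n))`_k)%:E) ->
  forall n k, P (X n @^-1` [set k]) = ((INAR1_pgf r m n)`_k)%:E.
Proof.
move=> hX xiE epsE.
pose later n : set (nat * nat + nat) := [set i | match i with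
  | inl (n', j) => (n < n')%N && (0 < j)%N | inr n' => (n < n')%N end].
(* These are the innovations that build [X n.+1] when [X n = k]: one immigration and [k] offspring
   variables. *)
pose step n k : seq (nat * nat + nat) :=
  inr n.+1 :: [seq inl (n.+1, j) | j <- index_iota 1 k.+1].
pose Y := innovations xi eps.
suff law n k : indep_event (later n) Y (X n @^-1` [set k]) /\
    P (X n @^-1` [set k]) = ((INAR1_pgf r m n)`_k)%:E.
  by move=> n k; case: (law n k).
elim: n k => [|n IH] l.
  have [<-|l0] := eqVneq 0%N l.
    rewrite (_ : X 0%N @^-1` _ = setT); last first.
      by apply/seteqP; split=> // w _; exact: INAR1_init hX w.
    rewrite probability_setT coefC; split=> //.
    exact/indep_event_setT/(INAR1_indep hX).
  rewrite (_ : X 0%N @^-1` _ = set0); last first.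
    apply/seteqP; split=> // w /=; rewrite (INAR1_init hX) => l0'.
    by rewrite l0' eqxx in l0.
  rewrite measure0 coefC eq_sym (negbTE l0); split=> //.
  exact: indep_event_set0.
pose q (i : nat * nat + nat) : {poly R} :=
  if i is inl _ then bernoulli_pgf (r n) else bernoulli_pgf (m n).
pose E k := X n @^-1` [set k] `&`
  [set w | 0 + \sum_(i <- step n k) Y i w = l]%N.
have EP k : indep_event (later n.+1) Y (E k) /\
    P (E k) = ((INAR1_pgf r m n)`_k *
      (bernoulli_pgf (m n) * bernoulli_pgf (r n) ^+ k)`_l)%:E.
  have [indA PA] := IH k.
  have [] := @indep_event_sum _ _ _ P _ (later n) Y _ _
    (step n k) q 0 l _ _ _ indA PA.
  - rewrite /= map_inj_uniq ?iota_uniq ?andbT; last by move=> a b [].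
    by apply/negP => /mapP[].
  - move=> i; rewrite /= in_cons => /orP[/eqP -> /=|/mapP[j]].
      exact: leqnn.
    by rewrite mem_index_iota => /andP[j0 _] -> /=; rewrite leqnn.
  - move=> i a; rewrite in_cons => /orP[/eqP -> /=|/mapP[j]]; first exact: epsE.
    by rewrite mem_index_iota => /andP[j0 _] -> /=; exact: xiE.
  move=> indE PE; split.
    (* All members of [step n k] have time index [n.+1], so removing them leaves [later n.+1]
       intact. *)
    apply: indep_eventS indE => -[[n' j]|n'] /=.
      move=> /andP[nn' j0]; split; first by rewrite ltnW.
      rewrite in_cons => /mapP[j' _ [n'E _]]; by rewrite n'E ltnn in nn'.
    move=> nn'; split; first exact: ltnW.
    rewrite in_cons => /orP[/eqP[n'E]|/mapP[]//]; by rewrite n'E ltnn in nn'.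
  rewrite PE /step big_cons big_map /= mul1r.
  by rewrite prodr_const_nat subn1.
have -> : X n.+1 @^-1` [set l] = \bigcup_k E k.
  have stepE w : X n.+1 w = (\sum_(i <- step n (X n w)) Y i w)%N.
    by rewrite (INAR1_step hX)//= big_cons big_map addnC.
  apply/seteqP; split=> w.
    by move=> /= Xl; exists (X n w) => //; split=> //=; rewrite add0n -stepE.
  by move=> [k _ [/= <-]]; rewrite add0n -stepE.
have tE : trivIset setT E.
  by apply/trivIsetP => a b _ _ ab; apply/seteqP; split=> // w;
    move=> [[/= Xa _] [/= Xb _]]; rewrite -Xa -Xb eqxx in ab.
split; first by apply: indep_event_bigcup => // k; exact: (EP k).1.
have mE k : measurable (E k) by have [[]] := EP k.
rewrite measure_semi_bigcup//; last exact: bigcup_measurable.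
rewrite (eq_eseriesr (fun k _ => (EP k).2)).
rewrite (@eseries_finite _ (fun k => (INAR1_pgf r m n)`_k *
   (bernoulli_pgf (m n) * bernoulli_pgf (r n) ^+ k)`_l)
   (size (INAR1_pgf r m n))); last first.
  by move=> k /(nth_default 0) ->; rewrite mul0r.
(* Summing over [k] the coefficients of the old generating function times powers of the Bernoulli
   one is polynomial composition. *)
rewrite /= comp_polyE mulr_suml coef_sum; congr _%:E.
by apply: eq_bigr => k _; rewrite -(scalerAl (INAR1_pgf r m n)`_k) coefZ
  (mulrC (bernoulli_pgf (m n))).
Qed.

(** * Poisson point masses and the limit theorem *)

Lemma poisson_prob_set1 (R : realType) (lambda : R) (k : nat) : 0 <= lambda ->
  poisson_prob lambda 0 [set k] =
  (lambda ^+ k / k`!%:R * expR (- lambda))%:E.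
Proof.
rewrite le_eqVlt => /orP[/eqP <-|l0]; rewrite /poisson_prob.
  (* At [lambda = 0] the convention [0 ^+ 0 = 1] makes the formula agree with the Dirac mass. *)
  rewrite ltxx diracE oppr0 expR0 mulr1; case: k => [|k].
    by rewrite mem_set// expr0 fact0 divr1.
  by rewrite memNset// expr0n mul0r.
rewrite l0 esum_set1 ?lee_fin ?poisson_pmf_ge0//.
by rewrite /poisson_pmf l0.
Qed.

Theorem theorem1 (d : measure_display) (T : measurableType d) (R : realType)
  (P : probability T R)
  (xi : nat -> nat -> {RV P >-> nat}) (eps X : nat -> {RV P >-> nat})
  (rho m1 : nat -> R) (lambda : R)
  (hX : inhomogeneous_INAR1 P xi eps X)
  (hrho : forall n, (0 < n)%N ->
     'E_P[@real_of_nat R \o xi n 1%N]%E = (rho n)%:E)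
  (hm1 : forall n, (0 < n)%N -> 'E_P[@real_of_nat R \o eps n]%E = (m1 n)%:E)
  (heps : forall n, (0 < n)%N -> P (eps n @^-1` [set 0%N; 1%N]) = 1%E)
  (hrho_lt1 : forall n, (0 < n)%N -> rho n < 1)
  (hrho_lim : rho n @[n --> \oo] --> (1 : R))
  (hrho_sum : (\sum_(1 <= n <oo) (1 - rho n)%:E)%E = +oo%E)
  (hlambda : 0 <= lambda)
  (hratio : m1 n / (1 - rho n) @[n --> \oo] --> lambda) :
  cvg_in_distribution P (fun n => @real_of_nat R \o X n) (Po lambda).

Proof.
(* The means are shifted because the model starts at time 1 while [INAR1_pgf] reads its parameters
   from index 0. *)
pose r n := rho n.+1; pose m n := m1 n.+1.
pose p n k := (INAR1_pgf r m n)`_k.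
pose q k := lambda ^+ k / k`!%:R * expR (- lambda).
have r01 n : 0 <= r n < 1.
  rewrite /r hrho_lt1// andbT.
  by have /andP[] := bernoulli_mean01 (INAR1_bernoulli hX (ltn0Sn n))
    (hrho _ (ltn0Sn n)).
have m01 n : 0 <= m n <= 1.
  exact: (bernoulli_mean01 (heps _ (ltn0Sn n)) (hm1 _ (ltn0Sn n))).
have law n k : P (X n @^-1` [set k]) = (p n k)%:E.
  apply: (INAR1_law hX) => {}n => [j|] {}k; last first.
    exact: (bernoulli_pmf (heps _ (ltn0Sn n)) (hm1 _ (ltn0Sn n))).
  move=> j0; have := INAR1_ident hX (ltn0Sn n) j0 [set k].
  rewrite /distribution /pushforward => ->.
  exact: (bernoulli_pmf (INAR1_bernoulli hX (ltn0Sn n)) (hrho _ (ltn0Sn n))).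
have q0 k : 0 <= q k by rewrite !mulr_ge0 ?expR_ge0 ?exprn_ge0.
(* Total masses are read off as values of generating functions at [x = 1]. *)
have pow1 (u : nat -> R) : u = (fun j => u j * 1 ^+ j).
  by apply/funext => j; rewrite expr1n mulr1.
have q1 : series q n @[n --> \oo] --> (1 : R).
  have := @poisson_pgf R lambda 1; rewrite subrr mulr0 oppr0 expR0.
  by rewrite [in X in _ -> X](pow1 q).
have p0 n k : 0 <= p n k by rewrite -lee_fin -law.
have p1 n : series (p n) k @[k --> \oo] --> (1 : R).
  have := @cvg_series_poly R (INAR1_pgf r m n) 1; rewrite INAR1_pgf_1.
  by rewrite [in X in _ -> X](pow1 (p n)).
have sum_oo : \sum_(0 <= k < n) (1 - r k) @[n --> \oo] --> +oo.
  have : (\sum_(1 <= n < N) (1 - rho n)%:E)%E @[N --> \oo] --> +oo%E.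
    rewrite -hrho_sum; apply: is_cvg_nneseries => n n1 _.
    by rewrite lee_fin subr_ge0 ltW// hrho_lt1.
  rewrite -cvg_shiftS /=.
  under eq_fun do rewrite sumEFin big_add1 /=.
  by move/cvgeryP.
have r1 : r n @[n --> \oo] --> (1 : R) by move: hrho_lim; rewrite -cvg_shiftS.
have ratio : m n / (1 - r n) @[n --> \oo] --> lambda.
  by move: hratio; rewrite -cvg_shiftS.
have pq k : p n k @[n --> \oo] --> q k.
  move: k; apply: (@pgf_cvg_pmf _ p q (fun n x => (INAR1_pgf r m n).[x])
    (fun x => expR (- (lambda * (1 - x))))) => [n k x x01|k x x01|x x01].
  - by apply: pgf_remainder => //; exact: cvg_series_poly.
  - by apply: pgf_remainder => //; exact: poisson_pgf.
  - by apply: INAR1_pgf_cvg.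
move=> f cf bf.
have [M fM] : exists M, forall k : nat, `|(f \o real_of_nat R) k| <= M.
  (* Boundedness gives a bound by every constant strictly above [M], hence the witness [M + 1]. *)
  have [M [_ bM]] := bf; exists (M + 1) => k.
  by apply: bM => //; rewrite ltrDl.
have mid : (idfun : nat -> nat) \in mfun by rewrite inE.
(* Under the Poisson measure on [nat] the identity is a Poisson variable, so the integral against
   [Po lambda] becomes an expectation over [nat]. *)
pose Z : {RV (poisson_prob lambda 0) >-> nat} := mfun_Sub mid.
have qE k : poisson_prob lambda 0 (Z @^-1` [set k]) = (q k)%:E.
  exact: poisson_prob_set1.
have -> : (\int[Po lambda]_x (f x)%:E)%E =
    ('E_(poisson_prob lambda 0)[(f \o real_of_nat R) \o Z])%E.
  rewrite unlock /Po integral_distribution//.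
    by apply/measurable_EFinP; exact: continuous_measurable_fun.
  by have /Lfun1_integrable := bounded_comp_Lfun1 Z fM.
exact: (nat_pmf_cvg_expectation law qE q1 pq fM).
Qed.
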